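(* Let $n\ge 2$, let $q\geq 1$, and let $\mathbf{x}_1,\mathbf{x}_2,\dots,\mathbf{x}_n$ be (jointly distributed) random variables with finitely many values. Then $$H_q(\mathbf{x}_1,\dots,\mathbf{x}_n)\leq \frac{1}{n-1}\sum_{i=1}^n H_q(\mathbf{x}_1,\dots,\mathbf{x}_{i-1},\mathbf{x}_{i+1},\dots,\mathbf{x}_n),$$ where $H_q$ denotes the Tsallis joint entropy.
   Context: For $q\ge 0$, $q\neq 1$ and $x>0$, $\ln_q(x)=\frac{x^{1-q}-1}{1-q}$, and $\ln_1(x)=\log x$. For jointly distributed finite-valued random variables $\mathbf{y}_1,\dots,\mathbf{y}_k$ with joint probability mass function $p(y_1,\dots,y_k)$, the Tsallis joint entropy is $$H_q(\mathbf{y}_1,\dots,\mathbf{y}_k)=-\sum_{y_1,\dots,y_k} p(y_1,\dots,y_k)^q\ln_q p(y_1,\dots,y_k),$$ where terms with $p(y_1,\dots,y_k)=0$ are taken to be $0$. For $q=1$ this is the Shannon joint entropy. On the right-hand side of the claim, the joint entropies are computed from the corresponding marginals of the joint distribution of $(\mathbf{x}_1,\dots,\mathbf{x}_n)$. *)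

(* Defs.v *)
From HB Require Import structures.
From mathcomp Require Import all_boot all_order all_algebra.
From mathcomp Require Import all_classical all_reals all_analysis.

Set Implicit Arguments.
Unset Strict Implicit.
Unset Printing Implicit Defensive.

Import Order.TTheory GRing.Theory Num.Theory.

Local Open Scope classical_set_scope.
Local Open Scope ring_scope.

Definition lnq (R : realType) (q x : R) : R :=
  if q == 1 then ln x else (x `^ (1 - q) - 1) / (1 - q).

(* Finite types carry no canonical sigma-algebra; for the discrete one,
   measurability amounts to measurability of the fibres. *)
Definition finite_random_variable (d : measure_display)
    (Omega : measurableType d) (A : finType) (X : Omega -> A) : Prop :=
  forall a : A, measurable (X @^-1` [set a]).

Section joint_entropy.
Variables (d : measure_display) (Omega : measurableType d) (R : realType).
Variables (P : probability Omega R) (k : nat) (A : 'I_k -> finType).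
Variable Y : forall j : 'I_k, Omega -> A j.

Definition joint_pmf (y : {dffun forall j : 'I_k, A j}) : R :=
  fine (P [set w | forall j : 'I_k, Y j w = y j]).

Definition tsallis_joint_entropy (q : R) : R :=
  - \sum_(y : {dffun forall j : 'I_k, A j} | joint_pmf y != 0)
      joint_pmf y `^ q * lnq q (joint_pmf y).

End joint_entropy.

(* Main.v *)
(* For q >= 1 conditioning does not increase the Tsallis entropy, so
   H(all) - H(all but i) = H(x_i | all but i) <= H(x_i | x_j, j < i); summing
   over i, the right-hand side telescopes to H(all).  Writing
   t^q ln_q t = t l(t), every marginal entropy is an expectation -E[l(m_S)] over
   the full joint law, m_S being the marginal mass on the coordinates in S.
   Conditioning then reduces to a termwise inequality coming from
   l(st) = l(s) + s^(q-1) l(t) and 1 - 1/t <= l(t), whose error terms sum to 0. *)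

Require Import Defs.
From HB Require Import structures.
From mathcomp Require Import all_boot all_order all_algebra.
From mathcomp Require Import all_classical all_reals all_analysis.
From mathcomp Require Import ring lra.

Set Implicit Arguments.
Unset Strict Implicit.
Unset Printing Implicit Defensive.

Import Order.TTheory GRing.Theory Num.Theory.

Local Open Scope classical_set_scope.
Local Open Scope ring_scope.

(** * The normalised deformed logarithm *)

(* Normalised so that [t * lnq_star q t = t `^ q * lnq q t]. *)
Definition lnq_star (R : realType) (q t : R) : R := t `^ (q - 1) * lnq q t.

(** On positive reals this is the deformed logarithm of parameter [2 - q]. *)
Lemma lnq_starE (R : realType) (q t : R) : 0 < t ->
  lnq_star q t = if q == 1 then ln t else (t `^ (q - 1) - 1) / (q - 1).
Proof.
move=> t0; rewrite /lnq_star /lnq; case: eqP => [->|/eqP q1].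
  by rewrite subrr powRr0 mul1r.
have q10 : q - 1 != 0 by rewrite subr_eq0.
have tN : t `^ (1 - q) = (t `^ (q - 1))^-1 by rewrite -powRN opprB.
rewrite tN -(opprB q 1); have : t `^ (q - 1) != 0 by rewrite gt_eqF ?powR_gt0.
by move: (t `^ _) => u u0; field; rewrite q10 u0.
Qed.

Lemma mulr_lnq_star (R : realType) (q t : R) : 0 < t ->
  t `^ q * lnq q t = t * lnq_star q t.
Proof.
move=> t0; rewrite /lnq_star mulrA; congr (_ * _).
rewrite -[X in X * _](powRr1 (ltW t0)) -powRD; first by rewrite addrC subrK.
by apply/implyP => _; rewrite gt_eqF.
Qed.

Lemma lnq_star1 (R : realType) (q : R) : lnq_star q 1 = 0.
Proof. by rewrite lnq_starE // ln1 powR1 subrr mul0r if_same. Qed.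

Lemma lnq_starM (R : realType) (q s t : R) : 0 < s -> 0 < t ->
  lnq_star q (s * t) = lnq_star q s + s `^ (q - 1) * lnq_star q t.
Proof.
move=> s0 t0; rewrite !lnq_starE ?mulr_gt0 //; case: eqP => [->|/eqP q1].
  by rewrite subrr powRr0 mul1r lnM.
have q10 : q - 1 != 0 by rewrite subr_eq0.
by rewrite powRM ?ltW //; field.
Qed.

(** [ln] satisfies the bound by [ln (1 + u) <= u] at [u = t^-1 - 1], and [lnq_star q] dominates [ln]
    by [1 + u <= expR u] at [u = (q - 1) * ln t]. *)
Lemma lnq_star_ge (R : realType) (q t : R) : 1 <= q -> 0 < t ->
  1 - t^-1 <= lnq_star q t.
Proof.
move=> q1 t0; have h : 1 - t^-1 <= ln t.
  have := @le_ln1Dx R (t^-1 - 1); rewrite addrCA subrr addr0 lnV ?posrE //.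
  by have := t0; rewrite -invr_gt0; lra.
apply: (le_trans h); rewrite lnq_starE //; case: eqP => [//|/eqP qn1].
have q10 : 0 < q - 1 by rewrite subr_gt0 lt_neqAle eq_sym qn1.
rewrite ler_pdivlMr // /powR gt_eqF // mulrC.
by have := @expR_ge1Dx R ((q - 1) * ln t); lra.
Qed.

(** Expanding [lnq_star q (t * t^-1) = 0] reduces the sign to that of [lnq_star q t^-1], which is at
    least [1 - t]. *)
Lemma lnq_star_le0 (R : realType) (q t : R) : 1 <= q -> 0 < t -> t <= 1 ->
  lnq_star q t <= 0.
Proof.
move=> q1 t0 t1.
have : lnq_star q (t * t^-1) = 0 by rewrite divff ?gt_eqF ?lnq_star1.
rewrite lnq_starM ?invr_gt0 // => /eqP; rewrite addr_eq0 => /eqP ->.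
rewrite oppr_le0 mulr_ge0 ?powR_ge0 //.
apply: le_trans (lnq_star_ge q1 _); last by rewrite invr_gt0.
by rewrite invrK subr_ge0.
Qed.

(** Meant for [a], [r], [s], [m] the masses of a point on all coordinates, on [S1], on [S2] and on
    [S1 :&: S2]; [a / r] and [s / m] are then conditional masses. *)
Lemma lnq_star_submodular_term (R : realType) (q a r s m : R) : 1 <= q ->
  0 < a -> a <= r -> r <= m -> 0 < s ->
  s `^ (q - 1) * (a - s * r / m) <=
  a * (lnq_star q a + lnq_star q m - lnq_star q r - lnq_star q s).
Proof.
move=> q1 a0 ar rm s0.
have r0 := lt_le_trans a0 ar; have m0 := lt_le_trans r0 rm.
have ar0 : 0 < a / r by rewrite divr_gt0.
have sm0 : 0 < s / m by rewrite divr_gt0.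
have u0 : 0 < a / r / (s / m) by rewrite divr_gt0.
have -> : lnq_star q a = lnq_star q r + r `^ (q - 1) * lnq_star q (a / r).
  by rewrite -lnq_starM //; congr lnq_star; field; rewrite gt_eqF.
have sE : s = m * (s / m) by field; rewrite gt_eqF.
have -> : lnq_star q s = lnq_star q m + m `^ (q - 1) * lnq_star q (s / m).
  by rewrite -lnq_starM // -sE.
have sP : s `^ (q - 1) = m `^ (q - 1) * (s / m) `^ (q - 1).
  by rewrite {1}sE powRM // ltW.
have arE : lnq_star q (a / r) = lnq_star q (s / m) +
    (s / m) `^ (q - 1) * lnq_star q (a / r / (s / m)).
  by rewrite -lnq_starM //; congr lnq_star; field; rewrite !gt_eqF.
(* Raising the base from [r] to [m] lowers the product, since [lnq_star q (a / r) <= 0] and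
   [q - 1 >= 0]. *)
have step1 : m `^ (q - 1) * lnq_star q (a / r) <=
             r `^ (q - 1) * lnq_star q (a / r).
  rewrite ler_wnM2r ?lnq_star_le0 ?ler_pdivrMr ?mul1r //.
  by rewrite ge0_ler_powR ?nnegrE ?subr_ge0 ?(ltW r0) ?(ltW m0).
(* Writing [a / r] as [s / m] times a ratio leaves only the logarithm of that ratio, bounded by
   [lnq_star_ge]. *)
have step2 : s `^ (q - 1) * (1 - (a / r / (s / m))^-1) <=
    m `^ (q - 1) * (lnq_star q (a / r) - lnq_star q (s / m)).
  rewrite arE addrAC subrr add0r mulrA -sP.
  by rewrite ler_wpM2l ?powR_ge0 ?lnq_star_ge.
have -> : s `^ (q - 1) * (a - s * r / m) =
    a * (s `^ (q - 1) * (1 - (a / r / (s / m))^-1)).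
  by move: (s `^ _) => w; field; rewrite !gt_eqF.
rewrite ler_wpM2l ?(ltW a0) //; apply: le_trans step2 _.
by move: step1; lra.
Qed.

(** * Marginals of a mass function on a finite product *)

Section marginals.
Variables (R : realType) (n : nat) (A : 'I_n -> finType).
Notation T := {dffun forall i : 'I_n, A i}.
Implicit Types (S : {set 'I_n}) (x y z : T).

Definition agree S x y := [forall i in S, x i == y i].

Lemma agreeP S x y : reflect (forall i, i \in S -> x i = y i) (agree S x y).
Proof. by apply: (iffP 'forall_in_eqP). Qed.

Lemma agree_refl S x : agree S x x. Proof. exact/agreeP. Qed.

Lemma agree_sym S x y : agree S x y = agree S y x.
Proof. by apply/agreeP/agreeP => h i /h. Qed.

Lemma agree_trans S y x z : agree S x y -> agree S y z -> agree S x z.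
Proof. by move=> /agreeP xy /agreeP yz; apply/agreeP => i iS; rewrite xy ?yz. Qed.

Lemma agreeS S S' x y : S \subset S' -> agree S' x y -> agree S x y.
Proof. by move=> /fintype.subsetP sS /agreeP h; apply/agreeP => i /sS /h. Qed.

(* As [S1] and [S2] cover, [x] is determined by [y] and [z]: it is [y] on [S1]
   and [z] elsewhere. *)
Lemma sum_agree_glue (S1 S2 : {set 'I_n}) (F : T -> R) y :
  S1 :|: S2 = [set: 'I_n]%SET ->
  \sum_(x | agree S1 y x) \sum_(z | agree S2 x z) F z =
  \sum_(z | agree (S1 :&: S2) y z) F z.
Proof.
move=> S12; rewrite (exchange_big_dep (fun z => agree (S1 :&: S2) y z)) /=; last first.
  move=> x z yx xz; apply: (@agree_trans _ x).
    by apply: agreeS yx; rewrite subsetIl.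
  by apply: agreeS xz; rewrite subsetIr.
apply: eq_bigr => z /agreeP yz.
pose x : T := [ffun i => if i \in S1 then y i else z i].
rewrite (big_pred1 x) // => x' /=; apply/andP/eqP => [[/agreeP yx /agreeP xz]|->].
  apply/ffunP => i; rewrite ffunE; case: ifPn => iS1; first by rewrite yx.
  rewrite xz //; have : i \in S1 :|: S2 by rewrite S12 inE.
  by rewrite inE (negbTE iS1).
split; apply/agreeP => i iS; rewrite ffunE; first by rewrite iS.
by case: ifPn => // iS1; rewrite yz // inE iS1.
Qed.

Variable p : T -> R.
Hypothesis p_ge0 : forall x, 0 <= p x.

(** Kept as a function of the whole point, so that marginals on different [S] live on one type. *)
Definition marg S x := \sum_(y | agree S x y) p y.

Lemma marg_agree S x y : agree S x y -> marg S x = marg S y.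
Proof.
move=> xy; apply: eq_bigl => z; apply/idP/idP; last exact: agree_trans.
by apply: agree_trans; rewrite agree_sym.
Qed.

Lemma marg_ge0 S x : 0 <= marg S x. Proof. exact: sumr_ge0. Qed.

Lemma le_marg S x : p x <= marg S x.
Proof. by rewrite /marg (bigD1 x) ?agree_refl //= lerDl sumr_ge0. Qed.

Lemma margS S S' x : S \subset S' -> marg S' x <= marg S x.
Proof.
move=> sS; rewrite /marg [leRHS](bigID (agree S' x)) /=.
rewrite -[leLHS]addr0; apply: lerD; last exact: sumr_ge0.
rewrite le_eqVlt; apply/orP; left; apply/eqP/eq_bigl => y.
by rewrite andbC; case: (boolP (agree S' x y)) => //= /(agreeS sS).
Qed.

Lemma marg_setT x : marg [set: 'I_n]%SET x = p x.
Proof.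
rewrite /marg (big_pred1 x) // => y /=; rewrite eq_sym.
by apply/agreeP/eqP => [h|-> //]; apply/ffunP => i; rewrite h.
Qed.

Lemma marg_set0 x : marg finset.set0 x = \sum_y p y.
Proof. by apply: eq_bigl => y; apply/agreeP => i; rewrite inE. Qed.

(** The quotient is the mass function making the [S1] and [S2] coordinates conditionally independent
    given the common ones. It has the same [S2] marginal as [p], and [w] depends on those
    coordinates only. *)
Lemma sum_marg_product (S1 S2 : {set 'I_n}) (w : T -> R) :
  S1 :|: S2 = [set: 'I_n]%SET ->
  (forall x y, agree S2 x y -> w x = w y) ->
  \sum_x w x * (marg S2 x * marg S1 x / marg (S1 :&: S2) x) = \sum_x w x * p x.
Proof.
move=> S12 wS2; pose I := S1 :&: S2.
have IS1 : I \subset S1 by rewrite subsetIl.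
transitivity (\sum_x \sum_(y | agree S1 x y) p y / marg I y * (w x * marg S2 x)).
  apply: eq_bigr => x _.
  transitivity (marg S1 x * (w x * marg S2 x / marg I x)); first by rewrite -/I; ring.
  rewrite {1}/marg mulr_suml; apply: eq_bigr => y xy.
  by rewrite (marg_agree (agreeS IS1 xy)); ring.
rewrite (exchange_big_dep xpredT) //=.
transitivity (\sum_y \sum_(z | agree I y z) p y / marg I y * (w z * p z)).
  apply: eq_bigr => y _; rewrite -!mulr_sumr; congr (_ * _).
  rewrite -(sum_agree_glue _ _ S12).
  apply: eq_big => [x|x _]; first by rewrite agree_sym.
  by rewrite mulr_sumr; apply: eq_bigr => z xz; rewrite (wS2 _ _ xz).
rewrite (exchange_big_dep xpredT) //=; apply: eq_bigr => z _.
(* Cancelling [marg I z] requires it to be nonzero, which [p z > 0] ensures. *)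
have [->|pz] := eqVneq (p z) 0; first by rewrite mulr0 big1 // => ? _; rewrite mulr0.
transitivity (\sum_(y | agree I z y) p y / marg I z * (w z * p z)).
  apply: eq_big => [y|y yz]; first by rewrite agree_sym.
  by rewrite (marg_agree yz).
rewrite -!mulr_suml -/(marg I z) divff ?mul1r // gt_eqF //.
by apply: lt_le_trans (le_marg I z); rewrite lt_def pz p_ge0.
Qed.

(** Strong subadditivity of the entropy: the termwise lower bounds sum to 0 by
    [sum_marg_product]. *)
Lemma lnq_star_submodular (q : R) (S1 S2 : {set 'I_n}) : 1 <= q ->
  S1 :|: S2 = [set: 'I_n]%SET ->
  0 <= \sum_x p x * (lnq_star q (p x) + lnq_star q (marg (S1 :&: S2) x)
                     - lnq_star q (marg S1 x) - lnq_star q (marg S2 x)).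
Proof.
move=> q1 S12; pose w x := marg S2 x `^ (q - 1).
have wS2 x y : agree S2 x y -> w x = w y by move=> /marg_agree xy; rewrite /w xy.
have sum0 : \sum_x w x * (p x - marg S2 x * marg S1 x / marg (S1 :&: S2) x) = 0.
  rewrite (eq_bigr _ (fun x _ => mulrBr _ _ _)) sumrB.
  by rewrite (sum_marg_product S12 wS2) subrr.
rewrite -[leLHS]sum0.
apply: ler_sum => x _; have [p0|pN0] := eqVneq (p x) 0.
  rewrite p0 mul0r sub0r mulrN oppr_le0.
  by rewrite mulr_ge0 ?powR_ge0 // mulr_ge0 ?invr_ge0 ?mulr_ge0 ?marg_ge0.
have p0 : 0 < p x by rewrite lt_def pN0 p_ge0.
apply: lnq_star_submodular_term => //; first exact: le_marg.
  by rewrite margS ?subsetIl.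
exact: lt_le_trans (le_marg _ _).
Qed.

Lemma han_lnq_star (q : R) : 1 <= q -> \sum_x p x = 1 ->
  \sum_(i < n) \sum_x p x * lnq_star q (marg [set~ i]%SET x) <=
  (n%:R - 1) * \sum_x p x * lnq_star q (p x).
Proof.
move=> q1 p1.
(* [S k] holds the first [k] coordinates, so [h] runs from the empty marginal, of mass 1, to the
   full law. *)
pose S k := [set j : 'I_n | (j < k)%N]%SET.
pose h k := \sum_x p x * lnq_star q (marg (S k) x).
pose F := \sum_x p x * lnq_star q (p x).
have h0 : h 0%N = 0.
  rewrite /h big1 // => x _.
  have -> : S 0%N = finset.set0
    by apply/setP => i; rewrite !inE.
  by rewrite marg_set0 p1 lnq_star1 mulr0.
have hn : h n = F.
  apply: eq_bigr => x _.
  have -> : S n = [set: 'I_n]%SET by apply/setP => i; rewrite !inE ltn_ord.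
  by rewrite marg_setT.
have step (i : 'I_n) : \sum_x p x * lnq_star q (marg [set~ i]%SET x) <=
    F - (h i.+1 - h i).
  have cover : [set~ i]%SET :|: S i.+1 = [set: 'I_n]%SET.
    by apply/setP => j; rewrite !inE; case: eqVneq => [->|//]; rewrite ltnSn.
  have capE : [set~ i]%SET :&: S i.+1 = S i.
    by apply/setP => j; rewrite !inE -(inj_eq val_inj) ltnS [RHS]ltn_neqAle.
  have := lnq_star_submodular q1 cover; rewrite capE.
  rewrite (eq_bigr _ (fun x _ => mulrBr _ _ _)) sumrB -/(h _).
  rewrite (eq_bigr _ (fun x _ => mulrBr _ _ _)) sumrB.
  rewrite (eq_bigr _ (fun x _ => mulrDr _ _ _)) big_split /= -/F -/(h _).
  by lra.
(* The [n] copies of [F] lose one to the telescoping sum [h n - h 0 = F]. *)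
apply: le_trans (ler_sum _ (fun i _ => step i)) _.
rewrite sumrB sumr_const card_ord -(big_mkord xpredT (fun i => h i.+1 - h i)).
by rewrite telescope_sumr // hn h0 subr0 mulrBl mul1r mulr_natl.
Qed.

End marginals.

(** * Joint laws of finite random variables and of their subfamilies *)

Section joint_pmf_theory.
Variables (R : realType) (d : measure_display) (Omega : measurableType d).
Variables (P : probability Omega R) (n : nat) (A : 'I_n -> finType).
Variable X : forall i : 'I_n, Omega -> A i.
Hypothesis hX : forall i : 'I_n, finite_random_variable (X i).
Notation T := {dffun forall i : 'I_n, A i}.
Notation p := (joint_pmf P X).

Lemma measurable_joint_event (x : T) : measurable [set w | forall i, X i w = x i].
Proof.
rewrite (_ : mkset _ = \bigcap_(i in [set: 'I_n]) X i @^-1` [set x i]).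
  by apply: fin_bigcap_measurable => // i _; exact: hX.
by apply/seteqP; split => w /= h i; [move=> _|]; exact: h.
Qed.

Lemma joint_pmf_ge0 x : 0 <= p x.
Proof. exact: fine_ge0. Qed.

(** The event is a finite disjoint union of measurable joint fibres. *)
Lemma sum_joint_pmf (Q : pred T) :
  \sum_(x | Q x) p x = fine (P [set w | Q [ffun i => X i w]]).
Proof.
have -> : [set w | Q [ffun i => X i w]] =
    \bigcup_(x in [set` Q]) [set w | forall i, X i w = x i].
  apply/seteqP; split => w /=.
    by move=> Qw; exists [ffun i => X i w] => //= i; rewrite ffunE.
  case=> x Qx /= wx; congr (is_true (Q _)): Qx.
  by apply/ffunP => i; rewrite ffunE wx.
rewrite measure_fin_bigcup //=; last 2 first.
- apply/trivIsetP => x y _ _ /eqP xy; apply/seteqP; split => // w /= [wx wy].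
  by apply: xy; apply/ffunP => i; rewrite -wx -wy.
- by move=> x _; exact: measurable_joint_event.
rewrite -(bigfs _ (r := index_enum T)) ?index_enum_uniq //; last first.
  by move=> x _; rewrite mem_index_enum.
rewrite -sum_fine // => x _.
by rewrite fin_num_measure //; exact: measurable_joint_event.
Qed.

Lemma sum_joint_pmfT : \sum_x p x = 1.
Proof.
rewrite sum_joint_pmf (_ : mkset _ = setT) ?probability_setT //.
by apply/seteqP; split.
Qed.

Section subfamily.
Variables (k : nat) (f : 'I_k -> 'I_n).

Let restr (x : T) : {dffun forall j : 'I_k, A (f j)} := [ffun j => x (f j)].
Let S := [set f j | j in 'I_k]%SET.

Lemma joint_pmf_subfamily (y : {dffun forall j : 'I_k, A (f j)}) :
  joint_pmf P (fun j => X (f j)) y = \sum_(x | restr x == y) p x.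
Proof.
rewrite sum_joint_pmf; congr (fine (P _)); apply/seteqP; split => w /=.
  by move=> h; apply/eqP/ffunP => j; rewrite !ffunE h.
by move=> /eqP <- j; rewrite !ffunE.
Qed.

Lemma joint_pmf_restr (x : T) :
  joint_pmf P (fun j => X (f j)) (restr x) = marg p S x.
Proof.
rewrite joint_pmf_subfamily; apply: eq_bigl => y; apply/eqP/agreeP => [h i|h].
  by case/imsetP => j _ ->; move/ffunP/(_ j): h; rewrite !ffunE.
by apply/ffunP => j; rewrite !ffunE h ?imset_f.
Qed.

(** Points are grouped by their restriction along [f]. Taking [f] to be [id] or [lift i] covers both
    sides of the theorem. *)
Lemma tsallis_subfamily (q : R) :
  tsallis_joint_entropy P (fun j => X (f j)) q =
  - \sum_x p x * lnq_star q (marg p S x).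
Proof.
congr (- _); set r := joint_pmf P _.
transitivity (\sum_y r y * lnq_star q (r y)).
  rewrite big_mkcond; apply: eq_bigr => y _.
  case: eqVneq => [->|ry] /=; first by rewrite mul0r.
  by rewrite mulr_lnq_star // lt_def ry fine_ge0.
rewrite [RHS](partition_big restr xpredT) //=; apply: eq_bigr => y _.
rewrite {1}/r joint_pmf_subfamily mulr_suml; apply: eq_bigr => x /eqP <-.
by rewrite -joint_pmf_restr.
Qed.

End subfamily.
End joint_pmf_theory.

Theorem theorem5p5 (R : realType) (n : nat) (hn : (2 <= n)%N)
    (q : R) (hq : 1 <= q)
    (d : measure_display) (Omega : measurableType d)
    (P : probability Omega R)
    (A : 'I_n -> finType) (X : forall i : 'I_n, Omega -> A i)
    (hX : forall i : 'I_n, finite_random_variable (X i)) :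
  tsallis_joint_entropy P X q <=
  1 / (n%:R - 1) *
    \sum_(i < n)
      tsallis_joint_entropy P (fun j : 'I_n.-1 => X (lift i j)) q.
Proof.
have n1 : 0 < n%:R - 1 :> R by rewrite subr_gt0 ltr1n.
have := han_lnq_star (joint_pmf_ge0 P X) hq (sum_joint_pmfT P hX).
have -> : tsallis_joint_entropy P X q =
    - \sum_x joint_pmf P X x * lnq_star q (joint_pmf P X x).
  (* The image of [id] is the whole index set, where the marginal is the joint law itself. *)
  rewrite (tsallis_subfamily P hX id); congr (- _); apply: eq_bigr => x _.
  rewrite (_ : imset _ _ = [set: 'I_n]%SET) ?marg_setT //.
  by apply/setP => i; rewrite inE; apply/imsetP; exists i.
rewrite [X in _ -> _ <= _ * X](_ : _ = - \sum_(i < n) \sum_x joint_pmf P X x *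
    lnq_star q (marg (joint_pmf P X) [set~ i]%SET x)); last first.
  rewrite -sumrN; apply: eq_bigr => i _.
  rewrite (tsallis_subfamily P hX (lift i)); congr (- _); apply: eq_bigr => x _.
  congr (_ * lnq_star q (marg _ _ x)); apply/setP => j; rewrite !inE.
  apply/imsetP/idP => [[l _ ->]|]; first by rewrite eq_sym neq_lift.
  by rewrite eq_sym => /unlift_some[l -> _]; exists l.
(* Clearing the positive factor [n - 1] and the signs leaves [han_lnq_star]. *)
by rewrite mul1r ler_pdivlMl // mulrN lerN2.
Qed.
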